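(* (a) For every integer $n>6$, the following bound is tight for the Johnson graph $G=J(n,3)$: if $N$ is the number of vertices of $G$, $\theta_0>\theta_1>\cdots>\theta_d$ are its distinct adjacency eigenvalues, and $\theta_i$ is the largest eigenvalue with $\theta_i\le-1$, then $$\mathrm{eq}_3(G)\le N\,\frac{\theta_0+\theta_i\theta_{i-1}}{(\theta_0-\theta_i)(\theta_0-\theta_{i-1})}.$$ (b) For every integer $n>8$, the following bound is tight for the Johnson graph $G=J(n,4)$: if $N$ is the number of vertices of $G$, $A$ its adjacency matrix, $\theta_0>\theta_1>\cdots>\theta_d$ its distinct adjacency eigenvalues, $\Delta_3=\max_{u}\{(A^3)_{uu}\}$, and $\theta_s$ is the largest eigenvalue with $\theta_s\le-\frac{\theta_0^2+\theta_0\theta_d-\Delta_3}{\theta_0(\theta_d+1)}$, then $$\mathrm{eq}_4(G)\le N\,\frac{\Delta_3-\theta_0(\theta_s+\theta_{s-1}+\theta_d)-\theta_s\theta_{s-1}\theta_d}{(\theta_0-\theta_s)(\theta_0-\theta_{s-1})(\theta_0-\theta_d)}.$$ Here ''tight'' means that the left-hand side equals the integer part (floor) of the right-hand side.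
   Context: The Johnson graph $J(n,k)$ has as vertices the $k$-element subsets of an $n$-element set, two being adjacent iff they differ in exactly one element (i.e. intersect in $k-1$ elements). It has $\binom nk$ vertices and adjacency eigenvalues $(k-j)(n-k-j)-j$ for $0\le j\le\min\{k,n-k\}$. A set $S\subseteq V(G)$ is $t$-equidistant if the shortest-path distance $d(u,v)=t$ for all distinct $u,v\in S$, and $\mathrm{eq}_t(G)$ is the maximum size of a $t$-equidistant set of $G$. *)

(* Defs.v *)
From mathcomp Require Import all_boot all_order all_algebra reals.

Set Implicit Arguments.
Unset Strict Implicit.
Unset Printing Implicit Defensive.

Import Order.TTheory GRing.Theory Num.Theory.
Local Open Scope ring_scope.

(* A graph is a finite type of vertices with a boolean adjacency relation.
   Here the condition forces S != T, so the relation has no loops. *)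
Definition johnson (n k : nat) : rel {S : {set 'I_n} | #|S| == k} :=
  fun S T => #|val S :&: val T|.+1 == k.
Arguments johnson n k : clear implicits.

Definition walk (V : finType) (e : rel V) (u v : V) (m : nat) : bool :=
  [exists p : m.-tuple V, path e u p && (last u p == v)].

(* The shortest-path distance, with None standing for infinity.  Lengths below
   #|V| suffice, since a shortest walk repeats no vertex: see distP. *)
Definition dist (V : finType) (e : rel V) (u v : V) : option nat :=
  ohead [seq m <- iota 0 #|V| | walk e u v m].

Lemma walkP (V : finType) (e : rel V) (u v : V) (m : nat) :
  reflect (exists p : seq V, [/\ size p = m, path e u p & last u p = v])
          (walk e u v m).
Proof.
apply: (iffP existsP) => [[p /andP[ep /eqP lp]]|[p [sp ep lp]]].
  by exists p; rewrite size_tuple.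
by exists (tcast sp (in_tuple p)); rewrite val_tcast ep lp /=.
Qed.

Lemma distP (V : finType) (e : rel V) (u v : V) (t : nat) :
  dist e u v = Some t <->
  walk e u v t /\ (forall m, walk e u v m -> (t <= m)%N).
Proof.
have short m : walk e u v m ->
    exists m', [/\ (m' <= m)%N, (m' < #|V|)%N & walk e u v m'].
  case/walkP=> p [<- ep lp]; case/shortenP: ep lp => p' ep' up' sub lp'.
  exists (size p'); split; last by apply/walkP; exists p'.
    by apply: uniq_leq_size => //; case/andP: up'.
  by have /card_uniqP/= <- := up'; apply: max_card.
have srt : sorted leq [seq m <- iota 0 #|V| | walk e u v m].
  by apply: sorted_filter (iota_sorted 0 _) => // ? ? ?; apply: leq_trans.
have mems m : (m \in [seq m <- iota 0 #|V| | walk e u v m]) =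
    walk e u v m && (m < #|V|)%N by rewrite mem_filter mem_iota.
rewrite /dist; split.
  case E: (filter _ _) srt mems => [|a s] //= srt mems [<-].
  have /andP[wa _] : walk e u v a && (a < #|V|)%N by rewrite -mems mem_head.
  split=> // m /short[m' [le_m'm lt_m'V wm']]; apply: leq_trans le_m'm.
  have: m' \in a :: s by rewrite mems wm'.
  rewrite inE => /predU1P[->//|].
  by have /allP := order_path_min leq_trans srt; apply.
case=> wt tmin.
have ltV : (t < #|V|)%N.
  by have [m' [_ lt_m'V wm']] := short _ wt; apply: leq_ltn_trans (tmin _ wm') _.
case E: (filter _ _) srt mems => [|a s] /= srt mems.
  by have := mems t; rewrite wt ltV.
have /andP[wa _] : walk e u v a && (a < #|V|)%N by rewrite -mems mem_head.
have: t \in a :: s by rewrite mems wt.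
rewrite inE => /predU1P[->//|ts].
have /allP/(_ _ ts) le_at := order_path_min leq_trans srt.
by congr Some; apply/eqP; rewrite eqn_leq le_at tmin.
Qed.

Definition equidistant (V : finType) (e : rel V) (t : nat) (S : {set V}) : bool :=
  [forall u in S, forall v in S, (u != v) ==> (dist e u v == Some t)].

Definition eqdist_number (V : finType) (e : rel V) (t : nat) : nat :=
  \max_(S : {set V} | equidistant e t S) #|S|.

Definition adjmx (R : realType) (V : finType) (e : rel V) : 'M[R]_#|V| :=
  \matrix_(i, j) (e (enum_val i) (enum_val j))%:R.

(* The default value 0 is harmless, the entries of A ^+ 3 being nonnegative. *)
Definition Delta3 (R : realType) (V : finType) (e : rel V) : R :=
  \big[Num.max/0]_(u < #|V|) (adjmx R e ^+ 3) u u.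

(* theta lists the distinct eigenvalues theta`_0 > ... > theta`_d. *)
Definition adj_spectrum (R : realType) (V : finType) (e : rel V)
    (d : nat) (theta : seq R) : Prop :=
  [/\ size theta = d.+1, sorted >%R theta &
      theta =i [pred a | eigenvalue (adjmx R e) a]].

(* theta`_i is the largest entry that is at most c. *)
Definition largest_at_most (R : realType) (d : nat) (theta : seq R) (c : R)
    (i : nat) : Prop :=
  [/\ (i <= d)%N, theta`_i <= c &
      forall j : nat, (j <= d)%N -> theta`_j <= c -> theta`_j <= theta`_i].

Definition tight (R : realType) (m : nat) (B : R) : Prop :=
  m%:Z = Num.floor B.

(* Main.v *)
Require Import Defs.
From mathcomp Require Import all_boot all_order all_algebra reals.
From mathcomp Require Import ring lra zify.

Import Order.TTheory GRing.Theory Num.Theory.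
Local Open Scope ring_scope.

(** Let M be the inclusion matrix of the k-subsets in the (k+1)-subsets of an
    n-set.  Then M^T M = A_{k+1} + (k+1) I and M M^T = A_k + (n-k) I, where A_k
    is the adjacency matrix of J(n,k).  The two products have the same nonzero
    eigenvalues, and M^T M is singular when 2k+1 < n because M has fewer rows
    than columns; this gives the spectrum of J(n,k+1) from that of J(n,k).  The
    neighbours of a vertex u arise from the pairs (x, y) in u x ~u by exchanging
    x for y, two of them being adjacent iff exactly one coordinate agrees, so
    Delta_3 = k (n-k) (n-2).  Finally d(u,v) = |u \ v|, so a k-equidistant set
    is a family of disjoint k-sets and eq_k = floor(n/k); both eigenvalue bounds
    evaluate to n/k. *)

(** * Inclusion matrices of consecutive subset layers *)

Local Notation ksubset n k := {S : {set 'I_n} | #|S| == k} (only parsing).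

Definition relmx (R : realType) (U V : finType) (r : U -> V -> bool) :
    'M[R]_(#|U|, #|V|) :=
  \matrix_(i, j) (r (enum_val i) (enum_val j))%:R.

Definition incl_mx (R : realType) (n k : nat) :=
  relmx R (ksubset n k) (ksubset n k.+1)
    (fun (S : ksubset n k) (T : ksubset n k.+1) => val S \subset val T).

Lemma card_ksubset n k : #|{: ksubset n k}| = 'C(n, k).
Proof. by rewrite card_sig -cardsE card_draws card_ord. Qed.

Lemma sum_ksubset {R : nzRingType} {n k : nat} (F : {set 'I_n} -> R) :
  \sum_(S : ksubset n k) F (val S) = \sum_(A : {set 'I_n} | #|A| == k) F A.
Proof. by rewrite (big_sub [pred A : {set 'I_n} | #|A| == k] F). Qed.

(** Complementation turns the supersets of [B] of size [k] into the subsets of [~: B] of size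
    [n - k]. *)
Lemma card_superdraws n (B : {set 'I_n}) k : (k <= n)%N ->
  #|[set A : {set 'I_n} | B \subset A & #|A| == k]| = 'C(n - #|B|, n - k).
Proof.
move=> le_kn; rewrite -(card_imset _ (@setC_inj _)).
have -> : (n - #|B|)%N = #|~: B| by have := cardsC B; rewrite card_ord; lia.
rewrite -(cards_draws (~: B)) //.
congr #|pred_of_set _|; apply/setP=> A; rewrite inE -[A in LHS]setCK.
rewrite (mem_imset _ _ (@setC_inj _)) inE -{1}[B]setCK setCS; congr (_ && _).
have := cardsC A; rewrite card_ord; lia.
Qed.

Lemma cardsI_ksubset {n k} (S T : ksubset n k) :
  (#|val S :&: val T| <= k)%N && ((#|val S :&: val T| == k) == (S == T)).
Proof.
have leS := subset_leqif_cards (subsetIl (val S) (val T)).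
rewrite (eqP (valP S)) in leS; rewrite leS andTb.
rewrite leS; apply/eqP; apply/eqP/eqP=> [/setIidPl sST|->]; last first.
  by rewrite setIid.
by apply/val_inj/eqP; rewrite eqEcard sST (eqP (valP S)) (eqP (valP T)) /=.
Qed.

(** The entry at (S, T) counts the [k]-subsets of the intersection: [k.+1] of them if S = T, one if
    S and T are adjacent, none otherwise. *)
Lemma incl_mxTM R n k :
  (incl_mx R n k)^T *m incl_mx R n k =
  adjmx R (johnson n k.+1) + (k.+1%:R)%:M.
Proof.
apply/matrixP=> i j; rewrite !mxE.
under eq_bigr => l _ do rewrite !mxE -natrM mulnb -subsetI.
set S : ksubset n k.+1 := enum_val i; set T : ksubset n k.+1 := enum_val j.
rewrite -(big_enum_val
  (fun P : ksubset n k => (val P \subset val S :&: val T)%:R)).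
rewrite (sum_ksubset (fun A => (A \subset val S :&: val T)%:R)).
rewrite -natr_sum -big_mkcondr sum1dep_card.
under eq_finset => A do rewrite andbC.
rewrite cards_draws /johnson eqSS -mulrnA -natrD; congr (_%:R).
have -> : (i == j) = (S == T) by rewrite (inj_eq enum_val_inj).
have /andP[] := cardsI_ksubset S T; rewrite leq_eqVlt => /predU1P[->|].
  by rewrite eqxx => /eqP <-; rewrite binSn gtn_eqF ?muln1.
rewrite ltnS leq_eqVlt => /predU1P[->|lt_k].
  by rewrite binn eqxx ltn_eqF // => /eqP <-; rewrite muln0.
by rewrite bin_small // !ltn_eqF // 1?ltnW // => /eqP <-; rewrite muln0.
Qed.

Lemma cardsU_ksubset {n k} (S T : ksubset n k) :
  (#|val S :|: val T| + #|val S :&: val T| = k + k)%N.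
Proof. by rewrite cardsUI (eqP (valP S)) (eqP (valP T)). Qed.

(** The entry at (S, T) counts the [k.+1]-sets containing the union, which has size [k] if S = T,
    [k.+1] if they are adjacent, and more otherwise. *)
Lemma incl_mxMT R n k : (k < n)%N ->
  incl_mx R n k *m (incl_mx R n k)^T =
  adjmx R (johnson n k) + ((n - k)%:R)%:M.
Proof.
move=> lt_kn; apply/matrixP=> i j; rewrite !mxE.
under eq_bigr => l _ do rewrite !mxE -natrM mulnb -subUset.
set S : ksubset n k := enum_val i; set T : ksubset n k := enum_val j.
rewrite -(big_enum_val
  (fun P : ksubset n k.+1 => (val S :|: val T \subset val P)%:R)).
rewrite (sum_ksubset (fun A => (val S :|: val T \subset A)%:R)).
rewrite -natr_sum -big_mkcondr sum1dep_card.
under eq_finset => A do rewrite andbC.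
rewrite card_superdraws // /johnson -mulrnA -natrD; congr (_%:R).
have -> : (i == j) = (S == T) by rewrite (inj_eq enum_val_inj).
clearbody S T.
have /andP[le_k] := cardsI_ksubset S T; have := cardsU_ksubset S T.
move: le_k; rewrite leq_eqVlt => /predU1P[->|lt_k] eU.
  have -> : #|val S :|: val T| = k by lia.
  rewrite eqxx => /eqP <-; rewrite gtn_eqF // subnS.
  by case: (n - k)%N (subn_gt0 k n) => [|m _]; rewrite ?lt_kn // binSn muln1.
rewrite ltn_eqF // => /eqP <-; rewrite muln0 addn0.
move: lt_k; rewrite leq_eqVlt => /predU1P[eI|lt_k].
  by rewrite eI eqxx (_ : #|_| = k.+1) ?binn //; lia.
(* This keeps the truncated difference [n - #|val S :|: val T|] strictly below [n - k.+1], so the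
   binomial vanishes. *)
have le_Un : (#|val S :|: val T| <= n)%N.
  by apply: leq_trans (max_card _) _; rewrite card_ord.
by rewrite ltn_eqF // bin_small //; lia.
Qed.

(** * Transfer of eigenvalues from J(n,k) to J(n,k+1) *)

Lemma eigenvalue_shift {F : fieldType} {n} (A : 'M[F]_n) (c a : F) :
  eigenvalue (A + c%:M) a = eigenvalue A (a - c).
Proof.
apply/eigenvalueP/eigenvalueP=> -[v vA v0]; exists v => //; apply/eqP.
  by rewrite scalerBl -vA mulmxDr mul_mx_scalar addrK.
by rewrite mulmxDr vA mul_mx_scalar -scalerDl subrK.
Qed.

(** A row eigenvector [v] of [A *m B] is sent to [v *m A], which is nonzero because multiplying it
    by [B] gives back [a *: v]. *)
Lemma eigenvalue_mulmxC_imp {F : fieldType} {m n}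
    (A : 'M[F]_(m, n)) (B : 'M_(n, m)) a :
  a != 0 -> eigenvalue (A *m B) a -> eigenvalue (B *m A) a.
Proof.
move=> a0 /eigenvalueP[v vAB v0]; apply/eigenvalueP; exists (v *m A).
  by rewrite mulmxA -(mulmxA v) vAB -scalemxAl.
apply: contra_neq v0 => vA0; apply/eqP; move/eqP: vAB.
by rewrite mulmxA vA0 mul0mx eq_sym scaler_eq0 (negPf a0).
Qed.

Lemma eigenvalue_mulmxC {F : fieldType} {m n}
    (A : 'M[F]_(m, n)) (B : 'M_(n, m)) a :
  a != 0 -> eigenvalue (A *m B) a = eigenvalue (B *m A) a.
Proof. by move=> a0; apply/idP/idP; apply: eigenvalue_mulmxC_imp. Qed.

Lemma eigenvalue_mulmx0 {F : fieldType} {m n}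
    (A : 'M[F]_(m, n)) (B : 'M_(n, m)) :
  (n < m)%N -> eigenvalue (A *m B) 0.
Proof.
move=> lt_nm; have : kermx A != 0.
  by rewrite kermx_eq0 /row_free ltn_eqF // (leq_ltn_trans (rank_leq_col A)).
case/rowV0Pn=> v /sub_kermxP vA v0; apply/eigenvalueP; exists v => //.
by rewrite mulmxA vA mul0mx scale0r.
Qed.

(** From (k+1) C(n,k+1) = (n-k) C(n,k) and n-k > k+1. This is what gives the inclusion matrix fewer
    rows than columns. *)
Lemma ltn_bin n k : (k.*2.+1 < n)%N -> ('C(n, k) < 'C(n, k.+1))%N.
Proof.
move=> lt_kn; have : (0 < 'C(n, k))%N by rewrite bin_gt0; lia.
by have := mul_bin_left n k; nia.
Qed.

(** Base of the induction: the only vertex is the empty set, and the adjacency matrix is the 1 by 1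
    zero matrix. *)
Lemma eigenvalue_johnson0 R n a :
  eigenvalue (adjmx R (johnson n 0)) a = (a == 0).
Proof.
have -> : adjmx R (johnson n 0) = 0 by apply/matrixP=> i j; rewrite !mxE.
apply/eigenvalueP/eqP => [[v]|->].
  by rewrite mulmx0 => /esym/eqP; rewrite scaler_eq0 => /orP[/eqP|->].
exists (const_mx 1); first by rewrite mulmx0 scale0r.
have c1 : (0 < #|{: ksubset n 0}|)%N by rewrite card_ksubset bin0.
by apply/eqP=> /rowP/(_ (Ordinal c1))/eqP; rewrite !mxE oner_eq0.
Qed.

Lemma eigenvalue_johnsonS R n k a : (k.*2.+1 < n)%N ->
  eigenvalue (adjmx R (johnson n k.+1)) a =
  (a == - k.+1%:R) ||
  eigenvalue (adjmx R (johnson n k)) (a + k.+1%:R - (n - k)%:R).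
Proof.
move=> lt_kn; rewrite -(addrK k.+1%:R a) -eigenvalue_shift -incl_mxTM addrK.
rewrite -eigenvalue_shift -incl_mxMT; last by lia.
(* Only nonzero eigenvalues pass between the two products; the eigenvalue 0, that is
   [a = - k.+1%:R], comes from singularity instead. *)
have [/eqP|a0] := eqVneq (a + k.+1%:R) 0.
  rewrite -addr_eq0 => a0; rewrite a0 orTb (eqP a0).
  by apply: eigenvalue_mulmx0; rewrite !card_ksubset; apply: ltn_bin.
by rewrite eigenvalue_mulmxC // -addr_eq0 (negPf a0).
Qed.

(** * Neighbours as exchanges, and the count of triangles *)

Definition swap {T : finType} (u : {set T}) (p : T * T) : {set T} :=
  p.2 |: (u :\ p.1).

Section Swap.
Context {T : finType} (u : {set T}).

Lemma setDswap p : p \in setX u (~: u) -> u :\: swap u p = [set p.1].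
Proof.
rewrite !inE => /andP[xu yu]; apply/setP=> z; rewrite !inE.
have [->|ne] := eqVneq z p.1; last by case: (z \in u); rewrite ?orbT ?andbF.
by rewrite xu orbF andbT; apply: contraNneq yu => <-.
Qed.

Lemma swapDset p : p \in setX u (~: u) -> swap u p :\: u = [set p.2].
Proof.
rewrite !inE => /andP[xu yu]; apply/setP=> z; rewrite !inE.
by have [->|] := eqVneq z p.2; rewrite ?yu //= andbA andbC; case: (z \in u).
Qed.

Lemma card_swap p : p \in setX u (~: u) -> #|swap u p| = #|u|.
Proof.
rewrite !inE => /andP[xu yu].
by rewrite cardsU1 !inE (negPf yu) andbF [RHS](cardsD1 p.1) xu.
Qed.

Lemma swap_inj : {in setX u (~: u) &, injective (swap u)}.
Proof.
move=> p q pX qX epq; have := setDswap _ pX; have := swapDset _ pX.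
rewrite epq setDswap // swapDset // => /set1_inj e2 /set1_inj e1.
by rewrite [p]surjective_pairing -e1 -e2 -surjective_pairing.
Qed.

Lemma swap_imset :
  swap u @: setX u (~: u) =
  [set A : {set T} | (#|A| == #|u|) && (#|u :&: A|.+1 == #|u|)].
Proof.
apply/setP=> A; rewrite inE; apply/imsetP/andP=> [[p pX ->]|[/eqP cA /eqP cuA]].
  rewrite card_swap // eqxx; split=> //.
  by rewrite -[X in _ == X](cardsID (swap u p)) setDswap // cards1 addn1.
have /eqP/cards1P[x ux] : #|u :\: A| = 1%N by have := cardsID A u; lia.
have /eqP/cards1P[y uy] : #|A :\: u| = 1%N.
  by have := cardsID u A; rewrite setIC; lia.
have /setDP[xu xA] : x \in u :\: A by rewrite ux set11.
have /setDP[yA yu] : y \in A :\: u by rewrite uy set11.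
exists (x, y); first by rewrite !inE xu.
apply/setP=> z; rewrite !inE /=.
have /setP/(_ z) := ux; have /setP/(_ z) := uy; rewrite !inE => <- <-.
by case: (z \in u); case: (z \in A).
Qed.

(** Writing [P] for 0 or 1, the union of the two exchanges has size |u| - [p.1 = q.1] + 1 +
    [p.2 <> q.2]. The intersection has size |u| - 1 exactly when the union has size |u| + 1, hence
    when exactly one coordinate agrees. *)
Lemma card_swapI p q : p \in setX u (~: u) -> q \in setX u (~: u) ->
  (#|swap u p :&: swap u q|.+1 == #|u|) = (p.1 == q.1) (+) (p.2 == q.2).
Proof.
move=> pX qX; have := cardsUI (swap u p) (swap u q).
rewrite !card_swap //.
have -> : swap u p :|: swap u q =
    (u :\: ([set p.1] :&: [set q.1])) :|: [set p.2; q.2].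
  apply/setP=> z; rewrite !inE; by case: (z \in u); do !case: eqP.
move: pX qX; rewrite !inE => /andP[xu yu] /andP[xu' yu'].
rewrite cardsU.
have -> : (u :\: ([set p.1] :&: [set q.1])) :&: [set p.2; q.2] = set0.
  apply/setP=> z; rewrite !inE.
  apply/negbTE/negP=> /andP[/andP[_ zu] /orP[]/eqP ez]; move: zu;
    by rewrite ez ?(negPf yu) ?(negPf yu').
rewrite cards0 subn0 cards2 cardsD.
have -> : u :&: ([set p.1] :&: [set q.1]) = [set p.1] :&: [set q.1].
  by apply/setIidPr; apply: subset_trans (subsetIl _ _) _; rewrite sub1set.
have [->|ne] := eqVneq p.1 q.1.
  rewrite setIid cards1; have : (0 < #|u|)%N by rewrite (cardsD1 p.1) xu.
  by case: eqP => /=; lia.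
have -> : [set p.1] :&: [set q.1] = set0.
  apply/setP=> z; rewrite !inE; apply/negbTE/negP=> /andP[/eqP-> /eqP e].
  by rewrite e eqxx in ne.
rewrite cards0 subn0; have : (1 < #|u|)%N.
  by rewrite (cardsD1 p.1) xu (cardsD1 q.1) !inE eq_sym ne xu'.
by case: eqP => /=; lia.
Qed.

End Swap.

Lemma sum_nat_neq (T : finType) (A : {set T}) x : x \in A ->
  (\sum_(y in A) (x != y) = #|A|.-1)%N.
Proof.
move=> xA; rewrite (bigD1 x) //= eqxx (cardsD1 x) xA /= add0n -sum1dep_card.
apply: eq_big => [y|y /andP[_]]; first by rewrite !inE andbC.
by rewrite eq_sym => ->.
Qed.

(** This is the degree of the rook's graph on [A] x [B]: the other cells of the row and of the
    column through [p]. *)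
Lemma sum_rook (T : finType) (A B : {set T}) (p : T * T) : p \in setX A B ->
  (\sum_(q in setX A B) ((p.1 == q.1) (+) (p.2 == q.2)) = #|A|.-1 + #|B|.-1)%N.
Proof.
rewrite inE => /andP[xA yB].
rewrite -(sum_nat_neq _ _ _ xA) -(sum_nat_neq _ _ _ yB) addnC.
under [LHS]eq_bigl => q do rewrite inE.
rewrite -(pair_big (mem A) (mem B)
  (fun x y => ((p.1 == x) (+) (p.2 == y)) : nat)) /=.
rewrite (bigD1 p.1) //=; congr (_ + _)%N.
  by apply: eq_bigr => y _; rewrite eqxx.
rewrite [RHS](bigD1 p.1) //= eqxx add0n.
apply: eq_bigr => x /andP[_ ne]; rewrite eq_sym (negPf ne) /=.
rewrite (bigD1 p.2) //= eqxx big1 // => y /andP[_ /negPf ney].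
by rewrite eq_sym ney.
Qed.

Lemma johnson_triangles n k (u : {set 'I_n}) : #|u| = k ->
  (\sum_(A : {set 'I_n} | #|A| == k) \sum_(B : {set 'I_n} | #|B| == k)
     (#|u :&: A|.+1 == k) * ((#|A :&: B|.+1 == k) * (#|B :&: u|.+1 == k))
   = k * (n - k) * (n - 2))%N.
Proof.
move=> uk.
pose N := [set A : {set 'I_n} | (#|A| == k) && (#|u :&: A|.+1 == k)].
transitivity (\sum_(A in N) \sum_(B in N) (#|A :&: B|.+1 == k))%N.
  under [RHS]eq_bigl => A do rewrite inE.
  rewrite big_mkcondr; apply: eq_bigr => A _.
  case: eqP => _; last by rewrite big1.
  under [RHS]eq_bigl => B do rewrite inE.
  rewrite [RHS]big_mkcondr; apply: eq_bigr => B _.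
  by rewrite mul1n [B :&: u]setIC mulnC mulnbl.
have -> : N = swap u @: setX u (~: u) by rewrite swap_imset uk.
rewrite big_imset; last exact: swap_inj.
have cu : #|~: u| = (n - k)%N by have := cardsC u; rewrite card_ord; lia.
transitivity (\sum_(p in setX u (~: u)) (n - 2))%N; last first.
  by rewrite sum_nat_const cardsX uk cu.
apply: eq_bigr => p pX; rewrite big_imset; last exact: swap_inj.
transitivity (\sum_(q in setX u (~: u)) ((p.1 == q.1) (+) (p.2 == q.2)))%N.
  by apply: eq_bigr => q qX; have := card_swapI u p q pX qX; rewrite uk => ->.
rewrite sum_rook // uk cu.
(* The pair [p] shows that [u] and its complement are nonempty, so the truncated sum
   [k.-1 + (n - k).-1] is indeed [n - 2]. *)
move: pX; rewrite inE => /andP[pu pu'].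
have : (0 < #|u|)%N by rewrite (cardsD1 p.1) pu.
have : (0 < #|~: u|)%N by rewrite (cardsD1 p.2) pu'.
by rewrite uk cu; lia.
Qed.

(** The diagonal entry counts closed walks of length 3 from [u], hence ordered pairs of adjacent
    neighbours of [u]. *)
Lemma johnson_cube_diag R n k i :
  (adjmx R (johnson n k) ^+ 3) i i = (k * (n - k) * (n - 2))%:R.
Proof.
pose u : ksubset n k := enum_val i.
rewrite -(johnson_triangles n k _ (eqP (valP u))) natr_sum exprS expr2 !mxE.
rewrite -(sum_ksubset (fun A => (\sum_(B : {set 'I_n} | #|B| == k)
     (#|val u :&: A|.+1 == k) *
     ((#|A :&: B|.+1 == k) * (#|B :&: val u|.+1 == k)))%:R)).
rewrite [RHS]big_enum_val; apply: eq_bigr => j _.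
pose v : ksubset n k := enum_val j.
rewrite !mxE mulr_sumr natr_sum.
rewrite -(sum_ksubset (fun B =>
  ((#|val u :&: val v|.+1 == k) *
   ((#|val v :&: B|.+1 == k) * (#|B :&: val u|.+1 == k)))%:R)).
rewrite [RHS]big_enum_val; apply: eq_bigr => l _.
by rewrite !mxE !natrM.
Qed.

Lemma Delta3_johnson R n k : (k <= n)%N ->
  Delta3 R (johnson n k) = (k * (n - k) * (n - 2))%:R.
Proof.
move=> le_kn; rewrite /Delta3.
under eq_bigr => i _ do rewrite johnson_cube_diag.
have c : (0 < #|{: ksubset n k}|)%N by rewrite card_ksubset bin_gt0.
(* The diagonal is constant and nonnegative, so the default 0 does not affect the maximum over the
   nonempty vertex set. *)
by rewrite (bigmax_eq_arg _ (Ordinal c)).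
Qed.

(** * Distances and equidistant sets *)

Lemma setDI_ksubset {n k} (S T : ksubset n k) :
  (#|val S :\: val T| + #|val S :&: val T| = k)%N.
Proof. by rewrite addnC cardsID (eqP (valP S)). Qed.

Lemma leq_cardsD_tri (T : finType) (A B C : {set T}) :
  (#|A :\: C| <= #|A :\: B| + #|B :\: C|)%N.
Proof.
apply: leq_trans (leq_card_setU _ _); apply: subset_leq_card.
apply/subsetP=> x; rewrite !inE.
by case: (x \in A); case: (x \in B); case: (x \in C).
Qed.

(** A walk of this length exchanges one element of S \ T for one of T \ S at each step. No walk is
    shorter: an edge contributes 1 to the triangle inequality [leq_cardsD_tri]. *)
Lemma dist_johnson n k (S T : ksubset n k) :
  dist (johnson n k) S T = Some #|val S :\: val T|.
Proof.
apply/distP; split=> [|m /walkP[p [<- ep <-]]].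
  apply/walkP; move eqm: #|val S :\: val T| => m.
  elim: m S eqm => [|m IHm] S eqm.
    exists [::]; split=> //=; apply: val_inj; apply/eqP.
    rewrite eqEcard (eqP (valP S)) (eqP (valP T)) leqnn andbT.
    by rewrite -setD_eq0 -cards_eq0 eqm.
  have /card_gt0P[x xST] : (0 < #|val S :\: val T|)%N by rewrite eqm.
  have /card_gt0P[y yTS] : (0 < #|val T :\: val S|)%N.
    by have := setDI_ksubset S T; have := setDI_ksubset T S; rewrite setIC; lia.
  have [/setDP[xS xT] /setDP[yT yS]] := (xST, yTS).
  have pX : (x, y) \in setX (val S) (~: val S) by rewrite !inE xS.
  have cS' : #|swap (val S) (x, y)| == k by rewrite card_swap // (valP S).
  pose S' : ksubset n k := exist (fun S : {set 'I_n} => #|S| == k) _ cS'.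
  have eqm' : #|val S' :\: val T| = m.
    have -> : val S' :\: val T = (val S :\: val T) :\ x.
      by apply/setP=> z; rewrite !inE /=; have [->|_] := eqVneq z y;
        [rewrite yT /= andbF | exact: andbCA].
    by move: eqm; rewrite (cardsD1 x) xST => -[].
  have [p [sp ep lp]] := IHm S' eqm'; exists (S' :: p); split=> //=.
    by rewrite sp.
  rewrite ep andbT /johnson.
  have : swap (val S) (x, y) \in swap (val S) @: setX (val S) (~: val S).
    exact: imset_f.
  by rewrite swap_imset inE (eqP (valP S)) => /andP[].
elim: p S ep => [|S' p IHp] S /=; first by rewrite setDv cards0.
case/andP=> eSS' /IHp; rewrite -add1n => le_p.
apply: leq_trans (leq_cardsD_tri _ _ (val S') _) (leq_add _ le_p).
by have := setDI_ksubset S S'; rewrite -[RHS](eqP eSS') -add1n => /addIn ->.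
Qed.

Lemma equidistant_johnson n k (F : {set ksubset n k}) :
  reflect (forall S T, S \in F -> T \in F -> S != T -> [disjoint val S & val T])
          (equidistant (johnson n k) k F).
Proof.
have E (S T : ksubset n k) :
    (dist (johnson n k) S T == Some k) = [disjoint val S & val T].
  rewrite dist_johnson -setI_eq0 -cards_eq0; have := setDI_ksubset S T.
  move=> eD; apply/eqP/eqP=> [[e]|e].
    by move: eD; rewrite e -[RHS]addn0 => /addnI.
  by move: eD; rewrite e addn0 => ->.
apply: (iffP forall_inP) => [h S T SF TF neST|h S SF].
  by have /forall_inP/(_ T TF)/implyP/(_ neST) := h S SF; rewrite E.
by apply/forall_inP=> T TF; apply/implyP=> neST; rewrite E; apply: h.
Qed.

(** Disjoint [k]-sets cover [#|F| * k] of the [n] points, which bounds their number; blocks of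
    consecutive points attain the bound. *)
Lemma eqdist_number_johnson n k : (0 < k)%N ->
  eqdist_number (johnson n k) k = (n %/ k)%N.
Proof.
move=> k_gt0; apply/eqP; rewrite eqn_leq; apply/andP; split.
  apply/bigmax_leqP=> F /equidistant_johnson disjF; rewrite leq_divRL //.
  have trF : trivIset [set val S | S in F].
    apply/trivIsetP=> _ _ /imsetP[S SF ->] /imsetP[T TF ->] neST.
    by apply: disjF => //; apply: contra_neq neST => ->.
  have [_] := leq_card_cover [set val S | S in F]; rewrite trF => /eqP ecover.
  have <- : #|cover [set val S | S in F]| = (#|F| * k)%N.
    rewrite ecover big_imset /=; last by move=> ? ? _ _; apply: val_inj.
    by rewrite -sum_nat_const; apply: eq_bigr => S _; apply/eqP/(valP S).
  by apply: leq_trans (max_card _) _; rewrite card_ord.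
(* Block [i] consists of the points [i * k + j] with [j < k]; the quotient by [k] recovers [i], so
   the blocks are disjoint. *)
have lt_n (i : 'I_(n %/ k)) (j : 'I_k) : (i * k + j < n)%N.
  apply: leq_trans (leq_trunc_div n k).
  by have := ltn_ord i; have := ltn_ord j; nia.
pose block i := [set Ordinal (lt_n i j) | j : 'I_k].
have block_k i : #|block i| == k.
  rewrite card_imset ?card_ord // => j j' [] /addnI; exact: ord_inj.
pose f i : ksubset n k := exist (fun S : {set 'I_n} => #|S| == k) _ (block_k i).
have blockE i x : x \in block i -> (x %/ k)%N = i.
  by case/imsetP=> j _ -> /=; rewrite divnMDl // (divn_small (ltn_ord j)) addn0.
have disj i j : i != j -> [disjoint block i & block j].
  move=> neij; apply/pred0P=> x; apply/negbTE/negP=> /=.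
  move=> /andP[/blockE xi /blockE]; rewrite xi => /ord_inj /eqP.
  by rewrite (negPf neij).
have f_inj : injective f.
  (* Two equal blocks with distinct indices would be disjoint from themselves, hence empty, against
     [k > 0]. *)
  move=> i j [eij]; apply/eqP/negPn/negP=> /disj; rewrite eij -setI_eq0 setIid.
  by rewrite -cards_eq0 (eqP (block_k j)) gtn_eqF.
rewrite -[X in (X <= _)%N]card_ord -(card_imset _ f_inj).
apply: leq_bigmax_cond; apply/equidistant_johnson=> S T.
move=> /imsetP[i _ ->] /imsetP[j _ ->] neij.
by apply: disj; apply: contra_neq neij => ->.
Qed.

(** * Explicit spectrum and evaluation of the bounds *)

Lemma tight_div (R : realType) n k (B : R) : (0 < k)%N -> B = n%:R / k%:R ->
  tight (n %/ k) B.
Proof.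
move=> k_gt0 ->; apply/esym/floor_def.
rewrite -[(_ + 1)%R]/(Posz _ + 1%:Z) -PoszD addn1 -!pmulrn.
have k0 : 0 < k%:R :> R by rewrite ltr0n.
rewrite ler_pdivlMr // ltr_pdivrMr // -!natrM ler_nat ltr_nat.
by rewrite leq_trunc_div ltn_ceil.
Qed.

Definition johnson_eig (R : realType) (n k j : nat) : R :=
  (k%:R - j%:R) * (n%:R - k%:R - j%:R) - j%:R.

(** The shift by (n-k) - (k+1) carries the [j]-th value for [k] to the [j]-th value for [k.+1], and
    the new value at [j = k.+1] is -(k+1). *)
Lemma eigenvalue_johnson R n k a : (k.*2 <= n)%N ->
  eigenvalue (adjmx R (johnson n k)) a =
  (a \in mkseq (johnson_eig R n k) k.+1).
Proof.
elim: k a => [|k IHk] a le_kn.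
  by rewrite eigenvalue_johnson0 inE /johnson_eig !subrr mul0r subr0.
rewrite eigenvalue_johnsonS; last lia.
rewrite IHk; last lia.
rewrite [in RHS]mkseqS mem_rcons inE {2}/johnson_eig subrr mul0r sub0r.
congr (_ || _); rewrite natrB; last lia.
apply/mapP/mapP=> -[j j_iota e]; exists j => //; move: e;
  by rewrite /johnson_eig -natr1; lra.
Qed.

Lemma adj_spectrum_unique {R : realType} {V : finType} {e : rel V} {d}
    {theta s : seq R} :
  adj_spectrum e d theta -> sorted >%R s ->
  (forall a, eigenvalue (adjmx R e) a = (a \in s)) ->
  theta = s /\ d = (size s).-1.
Proof.
move=> [sz srt eqt] srts eqs.
suff e_s : theta = s by rewrite -e_s sz.
apply: (irr_sorted_eq (leT := >%R)) => //.
- by move=> y x z /= lxy lyz; apply: lt_trans lyz lxy.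
- by move=> x; apply: ltxx.
by move=> a; rewrite eqt inE eqs.
Qed.

(** Iterated from C(n,0) = 1, this turns the number of vertices into a polynomial in [n] that
    [field] can handle. *)
Lemma natr_binS (R : realType) n k : (k <= n)%N ->
  'C(n, k.+1)%:R = 'C(n, k)%:R * (n%:R - k%:R) / k.+1%:R :> R.
Proof.
move=> le_kn; have k0 : k.+1%:R != 0 :> R by rewrite pnatr_eq0.
apply: (canRL (mulfK k0)).
by rewrite -natrB // -!natrM mulnC mul_bin_left mulnC.
Qed.

Theorem proposition19 (R : realType) :
  (forall n : nat, (6 < n)%N ->
   forall (d : nat) (theta : seq R),
   adj_spectrum (johnson n 3) d theta ->
   exists i : nat,
     [/\ (0 < i)%N,
         largest_at_most d theta (- 1) i &
         tight (eqdist_number (johnson n 3) 3)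
           (#|{: {S : {set 'I_n} | #|S| == 3%N}}|%:R *
            ((theta`_0 + theta`_i * theta`_i.-1) /
             ((theta`_0 - theta`_i) * (theta`_0 - theta`_i.-1))))])
  /\
  (forall n : nat, (8 < n)%N ->
   forall (d : nat) (theta : seq R),
   adj_spectrum (johnson n 4) d theta ->
   exists s : nat,
     [/\ (0 < s)%N,
         largest_at_most d theta
           (- ((theta`_0 ^+ 2 + theta`_0 * theta`_d - Delta3 R (johnson n 4)) /
               (theta`_0 * (theta`_d + 1)))) s &
         tight (eqdist_number (johnson n 4) 4)
           (#|{: {S : {set 'I_n} | #|S| == 4%N}}|%:R *
            ((Delta3 R (johnson n 4)
              - theta`_0 * (theta`_s + theta`_s.-1 + theta`_d)
              - theta`_s * theta`_s.-1 * theta`_d) /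
             ((theta`_0 - theta`_s) * (theta`_0 - theta`_s.-1) *
              (theta`_0 - theta`_d))))]).
Proof.
split=> n n_gt d theta spec_theta; move: (n_gt); rewrite -(ler_nat R) => n_ge.
  have le_n : (3.*2 <= n)%N by lia.
  have [|-> ->] := adj_spectrum_unique spec_theta _
    (fun a => eigenvalue_johnson R n 3 a le_n).
    by rewrite /= /johnson_eig !andbT; apply/and3P; split; lra.
  (* The eigenvalues are 3n-9, 2n-9, n-7 and -3. Since n > 6, the third is nonnegative, so the last
     is the only one at most -1. *)
  exists 3%N; rewrite /= /johnson_eig; split=> //.
    split=> //=; first lra.
    by case=> [|[|[|[|]]]] //= _; lra.
  rewrite eqdist_number_johnson //; apply: tight_div => //.
  (* The numerator is 12 and the denominator 6(n-1)(n-2), which leaves n/3. *)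
  rewrite card_ksubset !natr_binS ?bin0; try lia.
  by field; do ?[apply/andP; split]; lra.
have le_n : (4.*2 <= n)%N by lia.
have [|-> ->] := adj_spectrum_unique spec_theta _
  (fun a => eigenvalue_johnson R n 4 a le_n).
  by rewrite /= /johnson_eig !andbT; apply/and4P; split; lra.
rewrite Delta3_johnson; last by lia.
rewrite !natrM !natrB; try lia.
(* The eigenvalues are 4n-16, 3n-16, 2n-14, n-10 and -4. As Delta_3 is (n-2) times the first, the
   threshold is n-6; for n > 8 it lies strictly between n-10 and 2n-14. *)
exists 3%N; rewrite /= /johnson_eig; split=> //.
  rewrite (_ : - (_ / _) = n%:R - 6); last first.
    by field; do ?[apply/andP; split]; lra.
  split=> //=; first lra.
  by case=> [|[|[|[|[|]]]]] //= _; lra.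
rewrite eqdist_number_johnson //; apply: tight_div => //.
(* The numerator is 144 and the denominator 24(n-1)(n-2)(n-3), which leaves n/4. *)
rewrite card_ksubset !natr_binS ?bin0; try lia.
by field; do ?[apply/andP; split]; lra.
Qed.
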